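(* Let $\gamma>0$. For every $x\in\mathbb R^n$ and every $T>0$, $$V_\gamma(x)=\sup_{\lambda\in\Lambda}\inf_{\mathrm u\in\mathbb U}\min\Bigl\{\min_{t\in[0,T]}\max\bigl[e^{-\gamma t}\ell(\xi(t)),\ \max_{s\in[0,t]}e^{-\gamma s}c(\xi(s))\bigr],\ \max\bigl[e^{-\gamma T}V_\gamma(\xi(T)),\ \max_{t\in[0,T]}e^{-\gamma t}c(\xi(t))\bigr]\Bigr\},$$ where $\xi=\xi_x^{\mathrm u,\lambda[\mathrm u]}$.
   Context: Consider the system $\dot x(t)=f(x(t),\mathrm u(t),\mathrm d(t))$ for $t\ge 0$, $x(0)=x$, where $U\subset\mathbb R^{m_u}$ and $D\subset\mathbb R^{m_d}$ are compact convex sets and $f:\mathbb R^n\times U\times D\to\mathbb R^n$ is uniformly continuous, bounded, and Lipschitz continuous in $x$ uniformly in $(u,d)$ (time-invariant). Let $\mathbb U$ (resp. $\mathbb D$) be the set of Lebesgue measurable maps $[0,\infty)\to U$ (resp. $[0,\infty)\to D$). Let $\Lambda$ be the set of non-anticipative strategies $\lambda:\mathbb U\to\mathbb D$, i.e. for every $t\ge0$, if $\mathrm u(s)=\mathrm u'(s)$ for a.e. $s\in[0,t]$ then $\lambda[\mathrm u](s)=\lambda[\mathrm u'](s)$ for a.e. $s\in[0,t]$. For $x\in\mathbb R^n$, $\mathrm u\in\mathbb U$, $\mathrm d\in\mathbb D$, $\xi_x^{\mathrm u,\mathrm d}(\cdot)$ denotes the unique solution of the system; inside $\sup_\lambda\inf_{\mathrm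 u}$ expressions, $\xi(\cdot)$ abbreviates $\xi_x^{\mathrm u,\lambda[\mathrm u]}(\cdot)$. Let $\ell,c:\mathbb R^n\to\mathbb R$ be bounded and Lipschitz continuous. For $\gamma>0$ define the discounted reach-avoid value function $$V_\gamma(x):=\sup_{\lambda\in\Lambda}\inf_{\mathrm u\in\mathbb U}\inf_{t\in[0,\infty)}\max\Bigl\{e^{-\gamma t}\ell(\xi(t)),\ \max_{s\in[0,t]}e^{-\gamma s}c(\xi(s))\Bigr\}.$$ *)

(* Defs.v *)
(* R : realType, R^n = 'rV[R]_n (sup norm). *)
From mathcomp Require Import all_boot all_order all_algebra.
From mathcomp Require Import all_classical all_reals all_analysis.
Import Order.TTheory GRing.Theory Num.Theory numFieldNormedType.Exports.

Set Implicit Arguments.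
Unset Strict Implicit.
Unset Printing Implicit Defensive.

Local Open Scope ring_scope.
Local Open Scope classical_set_scope.

(* The real line equipped with the Lebesgue (= completed, Caratheodory)
   sigma-algebra; its measure is completed_lebesgue_measure. *)
Definition LebR (R : realType) := caratheodory_type ((wlength (R:=R) idfun)^*)%mu.

Notation leb := (@completed_lebesgue_measure _).

(* convexity of a subset of R^m *)
Definition convex_rV (R : realType) (m : nat) (A : set 'rV[R]_m) : Prop :=
  forall a b, A a -> A b -> forall t : R, 0 <= t <= 1 -> A (t *: a + (1 - t) *: b).

(* Admissible controls: Lebesgue measurable maps [0,oo) -> A
   (represented as maps R -> R^m; values at negative times are irrelevant). *)
Definition admissible (R : realType) (m : nat) (A : set 'rV[R]_m)
    (u : R -> 'rV[R]_m) : Prop :=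
  (forall t, 0 <= t -> A (u t)) /\
  (forall i : 'I_m,
     measurable_fun (`[0, +oo[ : set (LebR R)) ((fun t => u t 0 i) : LebR R -> R)).

(* Non-anticipative strategies lambda : UU -> DD *)
Definition nonanticipative_strategy (R : realType) (mu md : nat)
    (U : set 'rV[R]_mu) (D : set 'rV[R]_md)
    (lam : (R -> 'rV[R]_mu) -> (R -> 'rV[R]_md)) : Prop :=
  (forall u, admissible U u -> admissible D (lam u)) /\
  (forall u u', admissible U u -> admissible U u' -> forall t : R, 0 <= t ->
     {ae leb, forall s : LebR R, `[0, t] s -> u s = u' s} ->
     {ae leb, forall s : LebR R, `[0, t] s -> lam u s = lam u' s}).

(* xi is a (Caratheodory) solution on [0,oo) of xi' = f(xi,u,d), xi(0) = x *)
Definition is_solution (R : realType) (n mu md : nat)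
    (f : 'rV[R]_n -> 'rV[R]_mu -> 'rV[R]_md -> 'rV[R]_n)
    (x : 'rV[R]_n) (u : R -> 'rV[R]_mu) (d : R -> 'rV[R]_md)
    (xi : R -> 'rV[R]_n) : Prop :=
  xi 0 = x /\ {within `[0, +oo[, continuous xi} /\
  forall t : R, 0 <= t -> forall i : 'I_n,
    xi t 0 i = x 0 i + Rintegral leb (`[0, t] : set (LebR R))
                         (fun s => f (xi s) (u s) (d s) 0 i).

(* The (unique, under the standing assumptions) solution xi_x^{u,d}. *)
Definition traj (R : realType) (n mu md : nat)
    (f : 'rV[R]_n -> 'rV[R]_mu -> 'rV[R]_md -> 'rV[R]_n)
    (x : 'rV[R]_n) (u : R -> 'rV[R]_mu) (d : R -> 'rV[R]_md) : R -> 'rV[R]_n :=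
  match pselect (exists xi, is_solution f x u d xi) with
  | left h => proj1_sig (cid h)
  | right _ => fun _ => x
  end.

(* max_{s in [0,t]} e^{-gamma s} c(xi(s)) *)
Definition run_max (R : realType) (n : nat) (gamma : R) (c : 'rV[R]_n -> R)
    (xi : R -> 'rV[R]_n) (t : R) : R :=
  sup [set expR (- (gamma * s)) * c (xi s) | s in `[0, t]].

(* max{ e^{-gamma t} l(xi t), max_{s in [0,t]} e^{-gamma s} c(xi s) } *)
Definition ra_cost (R : realType) (n : nat) (gamma : R) (l c : 'rV[R]_n -> R)
    (xi : R -> 'rV[R]_n) (t : R) : R :=
  Num.max (expR (- (gamma * t)) * l (xi t)) (run_max gamma c xi t).

(* discounted reach-avoid value function V_gamma *)
Definition V_gamma (R : realType) (n mu md : nat)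
    (f : 'rV[R]_n -> 'rV[R]_mu -> 'rV[R]_md -> 'rV[R]_n)
    (U : set 'rV[R]_mu) (D : set 'rV[R]_md) (l c : 'rV[R]_n -> R)
    (gamma : R) (x : 'rV[R]_n) : R :=
  sup [set inf [set inf [set ra_cost gamma l c (traj f x u (lam u)) t
                        | t in `[0, +oo[]
               | u in admissible U]
       | lam in nonanticipative_strategy U D].

(* Main.v *)
Require Import Defs.
From mathcomp Require Import all_boot all_order all_algebra.
From mathcomp Require Import all_classical all_reals all_analysis.
From mathcomp Require Import measurable_realfun ring lra.
Import Order.TTheory GRing.Theory Num.Theory numFieldNormedType.Exports.
Local Open Scope ring_scope.
Local Open Scope classical_set_scope.

(** Caratheodory solutions exist, are unique and depend only on the controls up
    to null sets (Picard iteration in an exponentially weighted sup norm), so a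
    trajectory restarted at time [T] is the trajectory of the translated
    controls; this uses translation invariance of the completed Lebesgue
    measure. Hence the cost of a trajectory splits at [T] into its cost on
    [[0, T]] and the discounted cost of its tail.

    For [<=], a strategy [lam] and a control [u] on [[0, T]] induce the strategy
    [v |-> lam (u then v)] for the tail, which guarantees at most [V (xi T)].
    For [>=], follow [lam] up to [T] and then an [e]-optimal strategy chosen for
    the state [xi T]; no measurable selection is needed, since only one state
    [xi T] occurs for each control. *)

(** * Completed Lebesgue measure and its translations *)

Section leb_shift.
Context {R : realType}.
Implicit Types (a : R) (A : set (LebR R)).

Definition translate a (x : R) : R := x + a.

Lemma preimage_shift_ocitv a (b : R * R) :
  (translate a) @^-1` `]b.1, b.2]%classic =
  `]b.1 - a, b.2 - a]%classic.
Proof.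
by apply/seteqP; split=> x /=; rewrite !in_itv/= /translate ltrBlDr lerBrDr.
Qed.

Lemma wlength_translate a (x y : R) :
  wlength idfun (`]x - a, y - a]%classic : set R) =
  wlength idfun (`]x, y]%classic : set R).
Proof.
rewrite !wlength_itv/= !lte_fin ltrD2r.
by case: ifPn => // _; rewrite -!EFinB; congr (_%:E); ring.
Qed.

(** Pulling a countable cover of [A] by half-open intervals back along the translation gives a cover
    of the preimage with the same total length. As [leb] is an outer measure, this works for
    arbitrary [A]. *)
Lemma leb_preimage_shift_le a A :
  (leb ((translate a : LebR R -> LebR R) @^-1` A) <= leb A)%E.
Proof.
apply: le_ereal_inf_tmp => _ [F [mF AF] <-].
apply: ereal_inf_lbound.
exists (fun k => (translate a) @^-1` F k); first split.
- move=> k; case: (mF k) => b _ <-; rewrite preimage_shift_ocitv.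
  exact: is_ocitv.
- by move=> x /AF[k _ Fk]; exists k.
- apply: eq_eseriesr => k _; case: (mF k) => b _ <-.
  by rewrite preimage_shift_ocitv; exact: wlength_translate.
Qed.

(** The reverse inequality is the previous one for translation by [- a], applied to the preimage
    itself. *)
Lemma leb_preimage_shift a A :
  leb ((translate a : LebR R -> LebR R) @^-1` A) = leb A.
Proof.
apply/eqP; rewrite eq_le leb_preimage_shift_le/=.
have := leb_preimage_shift_le (- a)
  ((translate a : LebR R -> LebR R) @^-1` A).
by rewrite -comp_preimage (_ : _ \o _ = idfun)//; apply/funext => x /=; rewrite /translate; ring.
Qed.

(** Exposes the Caratheodory criterion, which is the definition of measurability on [LebR R]. *)
Lemma measurable_LebRP A : measurable A <->
  forall X : set (LebR R), leb X = (leb (X `&` A) + leb (X `&` ~` A))%E.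
Proof. split=> h; exact h. Qed.

Lemma translateKN a : translate (- a) \o translate a = id.
Proof. by apply/funext => x /=; rewrite /translate addrK. Qed.

(** The Caratheodory criterion for the preimage, tested on [X], is the criterion for [A] tested on
    the translate of [X], because the outer measure is translation invariant. *)
Lemma measurable_shift a :
  measurable_fun [set: LebR R] (translate a : LebR R -> LebR R).
Proof.
move=> _ A /measurable_LebRP mA; rewrite setTI; apply/measurable_LebRP => X.
rewrite -(leb_preimage_shift (- a) X) mA.
rewrite -(leb_preimage_shift a (_ `&` A)) -(leb_preimage_shift a (_ `&` ~` A)).
by rewrite !preimage_setI preimage_setC -comp_preimage translateKN.
Qed.

Lemma measurable_LebR (A : set R) : measurable A -> measurable (A : set (LebR R)).
Proof. by move=> mA; apply: sub_caratheodory. Qed.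

Lemma measurable_LebR_id : measurable_fun [set: LebR R] (fun x : LebR R => x : measurableTypeR R).
Proof. by move=> _ A mA; rewrite setTI; exact: measurable_LebR. Qed.

Lemma measurable_itv_LebR (i : interval R) : measurable ([set` i] : set (LebR R)).
Proof. exact: measurable_LebR. Qed.

Lemma leb_lebesgue (A : set R) : leb (A : set (LebR R)) = lebesgue_measure A.
Proof. by []. Qed.

Lemma measurable_fun_LebR (A : set R) (g : R -> R) : measurable A ->
  measurable_fun A g -> measurable_fun (A : set (LebR R)) (g : LebR R -> R).
Proof. by move=> mA mg _ B mB; apply: measurable_LebR; exact: mg. Qed.

Lemma leb_pushforward_translate a :
  pushforward leb (translate a : LebR R -> LebR R) = leb.
Proof. by apply/funext => A; exact: leb_preimage_shift. Qed.

(** Lets integrals of Borel functions pass between the completed measure and [lebesgue_measure]. *)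
Lemma leb_pushforward_id :
  pushforward leb (fun x : LebR R => x : measurableTypeR R) = lebesgue_measure.
Proof. by apply/funext. Qed.

Lemma ae_translate a (P : LebR R -> Prop) : {ae leb, forall x, P x} ->
  {ae leb, forall x, P (translate a x)}.
Proof.
move=> [A [mA A0 PA]]; exists ((translate a : LebR R -> LebR R) @^-1` A); split.
- by rewrite -[X in measurable X]setTI; exact: measurable_shift.
- by rewrite leb_preimage_shift.
- by move=> x /= Px; exact: PA.
Qed.

Lemma ae_mono (P Q : LebR R -> Prop) : (forall x, P x -> Q x) ->
  {ae leb, forall x, P x} -> {ae leb, forall x, Q x}.
Proof. by move=> PQ; apply: filterS. Qed.

Lemma ae_mono2 (P P' Q : LebR R -> Prop) : (forall x, P x -> P' x -> Q x) ->
  {ae leb, forall x, P x} -> {ae leb, forall x, P' x} -> {ae leb, forall x, Q x}.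
Proof. by move=> PQ; apply: filterS2. Qed.

Lemma measurable_translate_ge0 (g : R -> R) a : 0 <= a ->
  measurable_fun (`[0, +oo[%classic : set (LebR R)) (g : LebR R -> R) ->
  measurable_fun (`[0, +oo[%classic : set (LebR R)) (g \o translate a : LebR R -> R).
Proof.
move=> a0 mg.
apply: (measurable_comp (F := (`[0, +oo[%classic : set (LebR R))) (f := g : LebR R -> R)
    (g := translate a : LebR R -> LebR R)) => //.
- exact: measurable_itv_LebR.
- move=> y [x /= + <-]; rewrite !in_itv/= !andbT => x0.
  by rewrite /translate addr_ge0.
- exact: measurable_funTS (measurable_shift a).
Qed.

End leb_shift.

(** * Primitives of locally bounded measurable functions *)

Section primitives.
Context {R : realType}.
Implicit Types (g h : R -> R).

(** A class of integrands that are integrable on every compact interval of nonnegative times and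
    stable under translation forward in time, difference, absolute value and scaling. *)
Definition loc_bounded_meas g :=
  measurable_fun (`[0, +oo[ : set (LebR R)) (g : LebR R -> R) /\
  forall t, exists M, forall s, 0 <= s <= t -> `|g s| <= M.

(** Convertible with the integral in [is_solution], so the lemmas below apply there directly. *)
Definition prim g t : R := Rintegral leb (`[0, t] : set (LebR R)) g.

Lemma lbm_measurable g a b : 0 <= a -> loc_bounded_meas g ->
  measurable_fun (`[a, b] : set (LebR R)) (g : LebR R -> R).
Proof.
move=> a0 [mg _]; apply: measurable_funS mg; first exact: measurable_itv_LebR.
by move=> x /=; rewrite !in_itv/= andbT => /andP[/(le_trans a0)].
Qed.

Lemma leb_itv_lty (a b : R) : (leb (`[a, b]%classic : set (LebR R)) < +oo)%E.
Proof.
rewrite leb_lebesgue lebesgue_measure_itv/=; case: ifP => // _.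
by rewrite -EFinB ltry.
Qed.

Lemma lbm_integrable g a b : 0 <= a -> loc_bounded_meas g ->
  leb.-integrable (`[a, b] : set (LebR R)) (EFin \o g : LebR R -> \bar R).
Proof.
move=> a0 bg; have [_ /(_ b)[M gM]] := bg.
apply: measurable_bounded_integrable.
- exact: measurable_itv_LebR.
- exact: leb_itv_lty.
- exact: lbm_measurable.
- exists M; split; first exact: num_real.
  move=> r Mr s /=; rewrite in_itv/= => /andP[as_ sb].
  by apply: le_trans (ltW Mr); apply: gM; rewrite sb (le_trans a0).
Qed.

Lemma lbm_translate g a : 0 <= a -> loc_bounded_meas g -> loc_bounded_meas (g \o translate a).
Proof.
move=> a0 [mg bg]; split; first exact: measurable_translate_ge0.
move=> t; have [M gM] := bg (t + a); exists M => s /andP[s0 st].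
by apply: gM; rewrite /translate addr_ge0//= lerD2r.
Qed.

Lemma lbmB g h : loc_bounded_meas g -> loc_bounded_meas h -> loc_bounded_meas (g \- h).
Proof.
move=> [mg bg] [mh bh]; split; first exact: measurable_funB.
move=> t; have [M gM] := bg t; have [N hN] := bh t; exists (M + N) => s st.
by rewrite (le_trans (ler_normB _ _))// lerD ?gM ?hN.
Qed.

Lemma lbm_norm g : loc_bounded_meas g -> loc_bounded_meas (fun s => `|g s|).
Proof.
move=> [mg bg]; split; first exact: measurableT_comp.
by move=> t; have [M gM] := bg t; exists M => s st; rewrite normr_id gM.
Qed.

Lemma primB g h t : loc_bounded_meas g -> loc_bounded_meas h -> prim (g \- h) t = prim g t - prim h t.
Proof.
move=> bg bh; apply: RintegralB; first exact: measurable_itv_LebR.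
all: exact: lbm_integrable.
Qed.

Lemma le_prim g h t : loc_bounded_meas g -> loc_bounded_meas h -> (forall s, 0 <= s <= t -> g s <= h s) ->
  prim g t <= prim h t.
Proof.
move=> bg bh gh; apply: le_Rintegral; first exact: measurable_itv_LebR.
1,2: exact: lbm_integrable.
by move=> x /=; rewrite in_itv/= => /gh.
Qed.

Lemma le_norm_prim g h t : loc_bounded_meas g -> loc_bounded_meas h ->
  (forall s, 0 <= s <= t -> `|g s| <= h s) -> `|prim g t| <= prim h t.
Proof.
move=> bg bh gh; apply: (@le_trans _ _ (prim (fun s => `|g s|) t)).
  apply: le_normr_Rintegral; first exact: measurable_itv_LebR.
  exact: lbm_integrable.
apply: le_prim; [exact: lbm_norm|exact: bh|exact: gh].
Qed.

Lemma eq_prim g h t : loc_bounded_meas g -> loc_bounded_meas h ->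
  {ae leb, forall s : LebR R, `[0, t] s -> g s = h s} -> prim g t = prim h t.
Proof.
move=> bg bh gh; congr fine; apply: ae_eq_integral.
- exact: measurable_itv_LebR.
- by apply/measurable_EFinP; exact: lbm_measurable.
- by apply/measurable_EFinP; exact: lbm_measurable.
- by apply: filterS gh => x + /= => /[apply] ->.
Qed.

Lemma leb_itv0 : leb (`[0, 0]%classic : set (LebR R)) = 0%E.
Proof. by rewrite leb_lebesgue set_itv1 lebesgue_measure_set1. Qed.

Lemma prim0 g : loc_bounded_meas g -> prim g 0 = 0.
Proof.
move=> bg; transitivity (fine (0%:E : \bar R)); last by [].
congr fine; apply: null_set_integral; last exact: leb_itv0.
- exact: measurable_itv_LebR.
- by apply/measurable_EFinP; exact: lbm_measurable.
Qed.

(** Additivity over adjacent intervals, then the change of variables by translation, obtained from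
    invariance of [leb] as a pushforward. *)
Lemma prim_split g (a t : R) : 0 <= a -> 0 <= t -> loc_bounded_meas g ->
  prim g (a + t) = prim g a + prim (g \o translate a) t.
Proof.
move=> a0 t0 bg; rewrite /prim.
have U : (`[0, a + t]%classic : set R) = `[0, a] `|` `]a, a + t].
  by apply/seteqP; split=> x /=; rewrite !in_itv/=; [|case]; lra.
(* The null point 0 is split off because the remaining piece of the first integral lives on a
   half-open interval, whose preimage is half-open too. *)
have U' : (`[0, t]%classic : set R) = [set 0] `|` `]0, t].
  apply/seteqP; split=> x /=; rewrite !in_itv/=; last first.
    by case=> [->|]; rewrite ?lexx// => /andP[/ltW ->].
  by rewrite le_eqVlt => /andP[/orP[/eqP <-|->] ->]; [left|right].
have E0 : (`[0, 0]%classic : set R) = [set 0] by rewrite set_itv1.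
have ig := @lbm_integrable g 0 (a + t) (lexx 0) bg.
have it := @lbm_integrable _ 0 t (lexx 0) (lbm_translate _ _ a0 bg).
rewrite U Rintegral_setU; last 4 first.
- exact: measurable_itv_LebR.
- exact: measurable_itv_LebR.
- by rewrite -U.
- apply/disj_set2P; rewrite -subset0 => x /= []; rewrite !in_itv/=.
  by move=> /andP[_ xa] /andP[/lt_le_trans/(_ xa)]; rewrite ltxx.
congr (_ + _).
rewrite U' Rintegral_setU; last 4 first.
- by rewrite -E0; exact: measurable_itv_LebR.
- exact: measurable_itv_LebR.
- by rewrite -U'.
- apply/disj_set2P; rewrite -subset0 => x /= [->]; rewrite !in_itv/=.
  by rewrite ltxx.
have -> : Rintegral leb ([set 0] : set (LebR R)) (g \o translate a) = 0.
  by rewrite -E0; apply: prim0; exact: lbm_translate.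
rewrite add0r; congr fine.
have e : `]0, t]%classic = (translate a : LebR R -> LebR R) @^-1` `]a, a + t].
  by apply/seteqP; split=> x /=; rewrite !in_itv/= /translate ltrDr addrC lerD2l.
(* Extension by zero: [g] is measurable only on the half-line, while the change of variables asks
   for measurability on the whole space. *)
pose g' := (EFin \o g \_ `[0, +oo[) : LebR R -> \bar R.
transitivity (\int[leb]_(x in `]a, (a + t)%R]) g' x)%E.
  apply: eq_integral => x; rewrite inE/= in_itv/= => /andP[ax _].
  by rewrite /g' /= patchE ifT// inE/= in_itv/= andbT (le_trans a0)// ltW.
have mg' : measurable_fun [set: LebR R] g'.
  apply/measurable_EFinP/measurable_restrict => //.
    exact: measurable_itv_LebR.
  by rewrite setTI; case: bg.
have eg : {in `]0, t]%classic : set (LebR R),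
    g' \o translate a =1 EFin \o (g \o translate a)}.
  move=> x; rewrite inE/= in_itv/= => /andP[x0 _].
  rewrite /g' /= patchE ifT// inE/= in_itv/= andbT.
  by rewrite /translate addr_ge0// ltW.
rewrite -[in LHS](leb_pushforward_translate a) integral_pushforward.
- by rewrite -e; apply: eq_integral.
- exact: measurable_shift.
- exact: mg'.
- rewrite -e; apply: eq_integrable (fun x xt => esym (eg x xt)) _.
    exact: measurable_itv_LebR.
  apply: integrableS it; [exact: measurable_itv_LebR..|].
  by rewrite U' => x; right.
- exact: measurable_itv_LebR.
Qed.

Lemma lbm_continuous g : continuous g -> loc_bounded_meas g.
Proof.
move=> cg; split.
  apply: measurable_fun_LebR => //.
  by apply: measurable_funTS; exact: continuous_measurable_fun.
move=> t; have cgt : {within `[0, t], continuous g}.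
  exact: continuous_subspaceT.
have [M [_ gM]] := compact_bounded (continuous_compact cgt (@segment_compact _ 0 t)).
exists (M + 1) => s st; apply: (gM (M + 1)); first by rewrite ltrDl.
by exists s => //=; rewrite in_itv.
Qed.

(** Brings the integral to the Borel measure, where the fundamental theorem of calculus is
    available. *)
Lemma lebesgue_prim g (t : R) : continuous g -> 0 <= t ->
  prim g t = Rintegral lebesgue_measure `[0, t] g.
Proof.
move=> cg t0; congr fine.
transitivity (\int[pushforward leb (fun x : LebR R => x : measurableTypeR R)]_(x in
  (`[0%R, t]%classic : set R)) (g x)%:E)%E; last by rewrite leb_pushforward_id.
apply/esym; 
apply: (@integral_pushforward _ _ _ _ _ _ measurable_LebR_id _ _ (EFin \o g)).
- by apply/measurable_EFinP; exact: continuous_measurable_fun.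
- by apply: lbm_integrable => //; exact: lbm_continuous.
- exact: measurable_itv.
Qed.

Lemma continuous_expRM (K : R) : continuous (fun s => K * expR (K * s)).
Proof.
move=> s; apply: cvgMr; apply: (cvg_comp (fun s => K * s) expR).
  by apply: cvgMr; exact: cvg_id.
exact: continuous_expR.
Qed.

Lemma prim_expR (K t : R) : 0 <= t ->
  prim (fun s => K * expR (K * s)) t = expR (K * t) - 1.
Proof.
(* The fundamental theorem of calculus is applied on a nondegenerate interval, so [t = 0] is treated
   apart. *)
rewrite le_eqVlt => /predU1P[<-|t0].
  rewrite mulr0 expR0 subrr; apply: prim0.
  exact: lbm_continuous (continuous_expRM K).
have ce : continuous (fun s => expR (K * s)).
  move=> s; apply: (cvg_comp (fun s => K * s) expR).
    by apply: cvgMr; exact: cvg_id.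
  exact: continuous_expR.
rewrite lebesgue_prim ?(ltW t0)//; last exact: continuous_expRM.
rewrite /Rintegral (@continuous_FTC2 _ _ (fun s => expR (K * s)))//.
- by rewrite mulr0 expR0.
- by apply: continuous_subspaceT; exact: continuous_expRM.
- split.
  + by move=> z _; exact: ex_derive.
  + by apply/cvg_at_right_filter; exact: ce.
  + by apply/cvg_at_left_filter; exact: ce.
- move=> x _; rewrite derive1E derive_val.
  by rewrite /GRing.scale/= mulr1 mulrC.
Qed.

Lemma fine_leb_itv (t : R) : 0 <= t ->
  fine (leb (`[0, t]%classic : set (LebR R))) = t.
Proof.
move=> t0; rewrite leb_lebesgue lebesgue_measure_itv/= lte_fin.
case: ltP => /= h; first by rewrite subr0.
by apply/le_anti/andP.
Qed.

Lemma prim_cst (M t : R) : 0 <= t -> prim (fun=> M) t = M * t.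
Proof.
move=> t0; rewrite /prim Rintegral_cst; last exact: measurable_itv_LebR.
congr (_ * _); exact: fine_leb_itv.
Qed.

Lemma lbm_scale a g : loc_bounded_meas g -> loc_bounded_meas (fun s => a * g s).
Proof.
move=> [mg bg]; split; first exact: measurable_funM.
move=> t; have [M gM] := bg t; exists (`|a| * M) => s st.
by rewrite normrM ler_wpM2l// gM.
Qed.

Lemma prim_scale a g t : loc_bounded_meas g -> prim (fun s => a * g s) t = a * prim g t.
Proof.
move=> bg; apply: RintegralZl; first exact: measurable_itv_LebR.
exact: lbm_integrable.
Qed.

Lemma lbm_cst (a : R) : loc_bounded_meas (fun=> a).
Proof. by apply: lbm_continuous => s; exact: cvg_cst. Qed.

(** For [s <= t] the increment is the primitive at [t - s] of [g] translated by [s]. *)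
Lemma prim_lipschitz g M s t : loc_bounded_meas g -> (forall r, 0 <= r -> `|g r| <= M) ->
  0 <= s -> 0 <= t -> `|prim g s - prim g t| <= M * `|s - t|.
Proof.
move=> bg gM; wlog st : s t / s <= t => [wlg|].
  have [st|/ltW ts] := leP s t; first exact: wlg.
  by move=> s0 t0; rewrite distrC (distrC s); exact: wlg.
move=> s0 _; have e : t = s + (t - s) by rewrite addrC subrK.
have ts0 : 0 <= t - s by rewrite subr_ge0.
rewrite {1}e prim_split// opprD addrA subrr sub0r normrN distrC (ger0_norm ts0).
rewrite -(prim_cst M _ ts0); apply: le_norm_prim; first exact: lbm_translate.
  exact: lbm_cst.
by move=> r /andP[r0 _]; apply: gM; rewrite /translate addr_ge0.
Qed.

End primitives.

(** * Measurability of continuous functions of measurable vectors *)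

Section rV_norm.
Context {R : realType} {n : nat}.
Implicit Types v : 'rV[R]_n.

Lemma coord_le_norm v i : `|v 0 i| <= `|v|.
Proof.
rewrite [leRHS]/Num.norm/= mx_normrE.
exact: (@le_bigmax_cond _ _ _ _ (0, i) _ (fun ij : 'I_1 * 'I_n => `|v ij.1 ij.2|)).
Qed.

Lemma norm_le_coord v r : 0 <= r -> (forall i, `|v 0 i| <= r) -> `|v| <= r.
Proof.
move=> r0 vr; rewrite [leLHS]/Num.norm/= mx_normrE.
by apply/bigmax_leP; split=> // -[i j] _; rewrite ord1.
Qed.

End rV_norm.

Section measurable_rV.
Context (d : measure_display) (T : measurableType d) {R : realType}.
Variables (E : set T) (mE : measurable E).

(** For fixed [k] these countably many sets cover the domain, and [g] varies by at most
    [2 / (k + 1)] on each. *)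
Definition rat_box n (g : T -> 'rV[R]_n) (k : nat) (q : 'rV[rat]_n) :=
  [set s | forall i, `|g s 0 i - ratr (q 0 i)| < k.+1%:R^-1].

Definition measurable_rV n (g : T -> 'rV[R]_n) :=
  forall i, measurable_fun E (fun s => g s 0 i).

Lemma measurable_rat_box n (g : T -> 'rV[R]_n) k q : measurable_rV n g ->
  measurable (E `&` rat_box n g k q).
Proof.
move=> mg.
have -> : E `&` rat_box n g k q = E `&` \bigcap_(i in [set: 'I_n])
    (E `&` (fun s => g s 0 i) @^-1` ball (ratr (q 0 i) : R) k.+1%:R^-1).
  apply/seteqP; split=> s /= [Es h]; split=> // i.
    by move=> _; split=> //=; rewrite /ball/= distrC.
  by have [_ /=] := h i Logic.I; rewrite /ball/= distrC.
apply: measurableI => //; apply: fin_bigcap_measurable; first exact: finite_finset.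
by move=> i _; apply: mg => //; exact: measurable_ball.
Qed.

Lemma rat_box_exists n (g : T -> 'rV[R]_n) k s : exists q, rat_box n g k q s.
Proof.
have h i : exists q : rat, `|g s 0 i - ratr q| < k.+1%:R^-1.
  have [|q] := @rat_in_itvoo R (g s 0 i - k.+1%:R^-1) (g s 0 i + k.+1%:R^-1).
    by rewrite ltrBlDr -addrA ltrDl addr_gt0// invr_gt0.
  by rewrite in_itv/= => ab; exists q; rewrite distrC ltr_distl.
have [q hq] := choice h.
by exists (\row_i q i) => i; rewrite mxE.
Qed.

Lemma rat_box_dist n (g : T -> 'rV[R]_n) k q s s' :
  rat_box n g k q s -> rat_box n g k q s' -> `|g s - g s'| <= k.+1%:R^-1 + k.+1%:R^-1.
Proof.
move=> hs hs'; apply: norm_le_coord; first by rewrite addr_ge0// invr_ge0.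
move=> i; rewrite !mxE.
rewrite (_ : _ - _ = (g s 0 i - ratr (q 0 i)) - (g s' 0 i - ratr (q 0 i))); last by ring.
by rewrite (le_trans (ler_normB _ _))// lerD// ltW// ?hs ?hs'.
Qed.

(** Each superlevel set is a countable union of rational boxes. The modulus of continuity is asked
    only along values taken on [E], since the dynamics are controlled only for inputs in [U] and
    [D]. *)
Lemma measurable_continuous_comp3 n1 n2 n3 (g1 : T -> 'rV[R]_n1)
    (g2 : T -> 'rV[R]_n2) (g3 : T -> 'rV[R]_n3)
    (h : 'rV[R]_n1 -> 'rV[R]_n2 -> 'rV[R]_n3 -> R) :
  measurable_rV _ g1 -> measurable_rV _ g2 -> measurable_rV _ g3 ->
  (forall e, 0 < e -> exists2 delta, 0 < delta & forall s s', E s -> E s' ->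
    `|g1 s - g1 s'| < delta -> `|g2 s - g2 s'| < delta ->
    `|g3 s - g3 s'| < delta -> `|h (g1 s) (g2 s) (g3 s) - h (g1 s') (g2 s') (g3 s')| < e) ->
  measurable_fun E (fun s => h (g1 s) (g2 s) (g3 s)).
Proof.
move=> mg1 mg2 mg3 hc; set H := fun s => h (g1 s) (g2 s) (g3 s).
apply: (measurability _ (RGenOInfty.measurableE R)).
move=> _ [_ [a ->] <-].
pose I := (nat * 'rV[rat]_n1 * 'rV[rat]_n2 * 'rV[rat]_n3)%type.
pose box (j : I) := rat_box _ g1 j.1.1.1 j.1.1.2 `&`
  (rat_box _ g2 j.1.1.1 j.1.2 `&` rat_box _ g3 j.1.1.1 j.2).
(* Only boxes lying inside the superlevel set enter the union, so one inclusion is immediate. *)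
pose good (j : I) := forall s, E s -> box j s -> a < H s.
have -> : E `&` H @^-1` `]a, +oo[ =
    \bigcup_(j : I) (if `[< good j >] then E `&` box j else set0).
  apply/seteqP; split=> [s /= [Es]|s [j _]]; last first.
    by case: asboolP => // gj [Es bs]; split=> //=; rewrite in_itv/= andbT gj.
  rewrite in_itv/= andbT => aH.
  (* Conversely, boxes around [s] of mesh [1 / (k + 1) < delta / 2] keep the variation of [H] below
     the margin [H s - a], hence are good. *)
  have [delta d0 hd] := hc (H s - a) ltac:(by rewrite subr_gt0).
  have [k] := @ltr_add_invr R 0 (delta / 2) ltac:(by rewrite divr_gt0).
  rewrite add0r => kd.
  have [q1 b1] := rat_box_exists _ g1 k s.
  have [q2 b2] := rat_box_exists _ g2 k s.
  have [q3 b3] := rat_box_exists _ g3 k s.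
  have small (x : R) : x <= k.+1%:R^-1 + k.+1%:R^-1 -> x < delta.
    by move/le_lt_trans; apply; rewrite [ltRHS]splitr ltrD.
  exists (k, q1, q2, q3) => //; rewrite asboolT//.
  move=> s' Es' /= [b1' [b2' b3']].
  have := hd s s' Es Es' (small _ (rat_box_dist _ _ _ _ _ _ b1 b1'))
    (small _ (rat_box_dist _ _ _ _ _ _ b2 b2'))
    (small _ (rat_box_dist _ _ _ _ _ _ b3 b3')).
  by rewrite -/(H s) -/(H s') ltr_norml => /andP[_]; rewrite ltrD2l ltrNl opprK.
apply: countable_bigcupT_measurable; first exact: countableP.
move=> j; case: ifP => // _.
have -> : E `&` box j = (E `&` rat_box _ g1 j.1.1.1 j.1.1.2) `&`
  ((E `&` rat_box _ g2 j.1.1.1 j.1.2) `&` (E `&` rat_box _ g3 j.1.1.1 j.2)).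
  by rewrite /box; apply/seteqP; split=> s /=; tauto.
by apply: measurableI; [|apply: measurableI]; exact: measurable_rat_box.
Qed.

End measurable_rV.

(** * Limits from geometric error bounds *)

Section real_sequences.
Context {R : realType}.

(** Turns the error bounds of Picard iteration into exact identities and inequalities. *)
Lemma le0_geometric (y A : R) : (forall k, y <= A / 2 ^+ k) -> y <= 0.
Proof.
move=> h; rewrite leNgt; apply/negP => y0.
(* A positive majorant of [A], whose sign is arbitrary. *)
have A1 : 0 < `|A| + 1 by rewrite ltr_wpDl.
have e0 : 0 < y / (`|A| + 1) by rewrite divr_gt0.
have [k _ /(_ k)/=] := near_infty_natSinv_expn_lt (PosNum e0).
rewrite leqnn => /(_ erefl).
rewrite ltr_pdivlMr// mul1r => hk; have := lt_le_trans hk (h k).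
apply/negP; rewrite -leNgt mulrC ler_pM2l ?invr_gt0 ?exprn_gt0//.
by rewrite (le_trans (ler_norm _))// lerDl.
Qed.

(** The intervals of center [a k] and radius [r k] are nested; the supremum of their left endpoints
    lies in all of them. *)
Lemma nested_limit (a r : nat -> R) : (forall k, 0 <= r k) ->
  (forall k, `|a k.+1 - a k| <= r k - r k.+1) ->
  exists l, forall k, `|a k - l| <= r k.
Proof.
move=> r0 ar.
have lo k m : a k - r k <= a (k + m)%N - r (k + m)%N.
  elim: m => [|m IH]; first by rewrite addn0.
  apply: le_trans IH _; rewrite addnS.
  have := ar (k + m)%N; rewrite ler_norml; lra.
have hi k m : a (k + m)%N + r (k + m)%N <= a k + r k.
  elim: m => [|m IH]; first by rewrite addn0.
  apply: le_trans IH; rewrite addnS.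
  have := ar (k + m)%N; rewrite ler_norml; lra.
have lohi j k : a j - r j <= a k + r k.
  apply: le_trans (lo j k) _; apply: le_trans (hi k j); rewrite addnC.
  have := r0 (k + j)%N; lra.
exists (sup (range (fun k => a k - r k))) => k.
have ub : a k - r k <= sup (range (fun k => a k - r k)).
  by apply: ub_le_sup; [exists (a 0%N + r 0%N) => _ [j _ <-]|exists k].
have lb : sup (range (fun k => a k - r k)) <= a k + r k.
  by apply: ge_sup; [exists (a k - r k), k|move=> _ [j _ <-]].
rewrite ler_norml; lra.
Qed.

End real_sequences.

(** * Continuity and measurability of paths on the half-line *)

Section within_continuous.
Context {R : realType} {n : nat}.

Lemma maxr0_lipschitz (s t : R) :
  `|Num.max s 0 - Num.max t 0| <= `|s - t|.
Proof.
have := ler_norm (s - t); have := ler_norm (t - s); rewrite (distrC t).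
rewrite /Num.max; case: ifPn; case: ifPn; rewrite -?leNgt => ? ? ? ?;
rewrite ler_norml; lra.
Qed.

(** Composing with the 1-Lipschitz retraction [max t 0] extends the path to a continuous one on the
    whole line. *)
Lemma lipschitz_within_continuous (xi : R -> 'rV[R]_n) (M : R) : 0 <= M ->
  (forall s t, 0 <= s -> 0 <= t -> `|xi s - xi t| <= M * `|s - t|) ->
  {within `[0, +oo[, continuous xi}.
Proof.
move=> M0 lip; pose eta t := xi (Num.max t 0).
apply: (@subspace_eq_continuous _ _ _ eta).
  by move=> t; rewrite inE/= in_itv/= andbT /eta => /max_idPl ->.
apply: continuous_subspaceT => s; apply/cvgrPdist_le => e e0.
(* [M + 1] replaces [M] so that the division below is legitimate when [M = 0]. *)
have M1 : 0 < M + 1 by rewrite ltr_wpDl.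
near=> t; apply: le_trans (lip _ _ _ _) _; rewrite ?le_max ?lexx ?orbT//.
apply: (@le_trans _ _ ((M + 1) * `|s - t|)).
  by apply: ler_pM => //; [rewrite lerDl|exact: maxr0_lipschitz].
rewrite -ler_pdivlMl//; near: t; apply: cvgr_dist_le; first exact: cvg_id.
by rewrite mulr_gt0// invr_gt0.
Unshelve. all: by end_near. Qed.

Lemma measurable_within_continuous (xi : R -> 'rV[R]_n) i :
  {within `[0, +oo[, continuous xi} ->
  measurable_fun (`[0, +oo[ : set (LebR R)) ((fun s => xi s 0 i) : LebR R -> R).
Proof.
move=> cxi; apply: measurable_fun_LebR => //.
apply: subspace_continuous_measurable_fun => // x.
apply: (cvg_comp xi (fun v : 'rV[R]_n => v 0 i)); first exact: cxi.
exact: coord_continuous.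
Qed.

End within_continuous.

(** * Translation and concatenation of controls *)

Section admissible_controls.
Context {R : realType}.
Local Notation halfline := (`[0, +oo[%classic : set (LebR R)).

Lemma admissible_translate m (A : set 'rV[R]_m) u a : 0 <= a ->
  admissible A u -> admissible A (u \o translate a).
Proof.
move=> a0 [Au mu]; split=> [t t0|i]; first by apply: Au; rewrite addr_ge0.
exact: (measurable_translate_ge0 (fun t => u t 0 i)).
Qed.

(** The switch already takes place at time [a]. Translating by [a] thus recovers [v] at every
    nonnegative time, while agreement with [u] on the closed interval up to [a] holds only off the
    null set of the point [a]. *)
Definition concat {X : Type} (a : R) (u v : R -> X) s :=
  if s < a then u s else v (s - a).

Lemma concat_translate {X : Type} (a : R) (u v : R -> X) s : 0 <= s ->
  (concat a u v \o translate a) s = v s.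
Proof.
by move=> s0; rewrite /= /concat /translate addrK ltNge lerDr s0.
Qed.

Lemma admissible_concat m (A : set 'rV[R]_m) u v a : 0 <= a ->
  admissible A u -> admissible A v -> admissible A (concat a u v).
Proof.
move=> a0 [Au mu] [Av mv]; split=> [t t0|i].
  rewrite /concat; case: ltP => ta; first exact: Au.
  by apply: Av; rewrite subr_ge0.
have -> : (fun t => concat a u v t 0 i) =
    (fun t => if t < a then u t 0 i else v (t - a) 0 i).
  by apply/funext => t; rewrite /concat; case: ifP.
have mlt : measurable_fun halfline (fun t : LebR R => (t : R) < a).
  apply: measurable_fun_ltr.
    by apply: measurable_funTS; exact: measurable_LebR_id.
  exact: measurable_cst.
apply: (@measurable_fun_if _ _ (LebR R) R (fun t => u t 0 i)
  (fun t => v (t - a) 0 i) halfline).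
- exact: measurable_itv_LebR.
- exact: mlt.
- apply: measurable_funS (mu i); first exact: measurable_itv_LebR.
  exact: subIsetl.
- apply: (measurable_comp (F := halfline) (f := (fun t => v t 0 i) : LebR R -> R)
    (g := translate (- a) : LebR R -> LebR R)).
  + exact: measurable_itv_LebR.
  + move=> y [x /= [_ +] <-] => /negbT; rewrite -leNgt in_itv/= andbT => xa.
    by rewrite /translate subr_ge0.
  + exact: mv.
  + exact: measurable_funTS (measurable_shift (- a)).
Qed.

Lemma admissible_cst m (A : set 'rV[R]_m) a : A a -> admissible A (fun=> a).
Proof. by move=> Aa; split=> // i; exact: measurable_cst. Qed.

Lemma ae_neq (a : R) : {ae leb, forall s : LebR R, s <> a}.
Proof.
exists ([set a] : set (LebR R)); split.
- by apply: measurable_LebR; exact: measurable_set1.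
- by rewrite leb_lebesgue lebesgue_measure_set1.
- by move=> s /= /contrapT.
Qed.

Lemma ae_concat {X : Type} (a : R) (u v : R -> X) :
  {ae leb, forall s : LebR R, `[0, a] s -> concat a u v s = u s}.
Proof.
apply: filterS (ae_neq a) => s sa /=; rewrite in_itv/= => /andP[_].
by rewrite le_eqVlt /concat => /predU1P[//|->].
Qed.

End admissible_controls.

(** * Costs *)

Section sup_inf_image.
Context {R : realType} {T : Type}.
Implicit Types (F : T -> R) (P : set T) (b y : R).

(** The bound [b] is explicit because a real [sup] dominates its set only when that set is bounded
    above. *)
Lemma sup_image_ge F P b t : (forall t, P t -> F t <= b) -> P t ->
  F t <= sup [set F t | t in P].
Proof.
by move=> h Pt; apply: ub_le_sup; [exists b => _ [s Ps <-]; exact: h|exists t].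
Qed.

Lemma sup_image_le F P b : P !=set0 -> (forall t, P t -> F t <= b) ->
  sup [set F t | t in P] <= b.
Proof.
move=> [t Pt] h; apply: ge_sup; first by exists (F t), t.
by move=> _ [s Ps <-]; exact: h.
Qed.

Lemma sup_image_adherent F P b e : P !=set0 -> (forall t, P t -> F t <= b) ->
  0 < e -> exists2 t, P t & sup [set F t | t in P] - e < F t.
Proof.
move=> [t Pt] h e0; have [|_ [s Ps <-] hs] := @sup_adherent _ [set F t | t in P] _ e0.
  split; first by exists (F t), t.
  by exists b => _ [s Ps <-]; exact: h.
by exists s.
Qed.

Lemma inf_image_le F P b t : (forall t, P t -> b <= F t) -> P t ->
  inf [set F t | t in P] <= F t.
Proof.
by move=> h Pt; apply: ge_inf; [exists b => _ [s Ps <-]; exact: h|exists t].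
Qed.

Lemma inf_image_ge F P b : P !=set0 -> (forall t, P t -> b <= F t) ->
  b <= inf [set F t | t in P].
Proof.
move=> [t Pt] h; apply: lb_le_inf; first by exists (F t), t.
by move=> _ [s Ps <-]; exact: h.
Qed.

Lemma inf_image_lt F P b y : P !=set0 -> (forall t, P t -> b <= F t) ->
  inf [set F t | t in P] < y -> exists2 t, P t & F t < y.
Proof.
move=> P0 h Py; apply: contrapT => hn; move: Py; apply/negP; rewrite -leNgt.
apply: inf_image_ge => // t Pt; rewrite leNgt; apply/negP => Fy.
by apply: hn; exists t.
Qed.

End sup_inf_image.

Section cost.
Context {R : realType} {n : nat} (gamma : R) (l c : 'rV[R]_n -> R) (B : R).
Hypothesis gamma0 : 0 <= gamma.
Hypothesis lB : forall x, `|l x| <= B.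
Hypothesis cB : forall x, `|c x| <= B.
Implicit Types (xi eta : R -> 'rV[R]_n) (s t T : R).

Local Notation disc t := (expR (- (gamma * t))).

(** The innermost infimum of [V_gamma], isolated as a functional of one path. *)
Definition cost xi : R := inf [set ra_cost gamma l c xi t | t in `[0, +oo[].

Lemma disc_le1 t : 0 <= t -> disc t <= 1.
Proof. by move=> t0; rewrite -expR0 ler_expR oppr_le0 mulr_ge0. Qed.

Lemma discD s t : disc (s + t) = disc t * disc s.
Proof. by rewrite -expRD; congr expR; ring. Qed.

Lemma disc_norm_le (a : R) t : 0 <= t -> `|a| <= B -> `|disc t * a| <= B.
Proof.
move=> t0 aB; rewrite normrM ger0_norm ?expR_ge0//.
apply: le_trans aB; rewrite -[leRHS]mul1r ler_wpM2r//; exact: disc_le1.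
Qed.

Lemma run_max_ge xi s t : 0 <= s <= t -> disc s * c (xi s) <= run_max gamma c xi t.
Proof.
move=> st; apply: (@sup_image_ge _ _ (fun s => disc s * c (xi s)) _ B).
  move=> r /=; rewrite in_itv/= => /andP[r0 _].
  by apply: le_trans (ler_norm _) _; exact: disc_norm_le.
by rewrite /= in_itv.
Qed.

Lemma run_max_le xi t b : 0 <= t ->
  (forall s, 0 <= s <= t -> disc s * c (xi s) <= b) -> run_max gamma c xi t <= b.
Proof.
move=> t0 h; apply: sup_image_le; first by exists 0; rewrite /= in_itv/= lexx.
by move=> s /=; rewrite in_itv/=; exact: h.
Qed.

Lemma run_max_norm_le xi t : 0 <= t -> `|run_max gamma c xi t| <= B.
Proof.
move=> t0; rewrite ler_norml; apply/andP; split.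
  apply: le_trans (run_max_ge xi 0 t _); last by rewrite lexx.
  by have := disc_norm_le _ 0 (lexx _) (cB (xi 0)); rewrite ler_norml => /andP[].
apply: run_max_le => // s /andP[s0 _].
by apply: le_trans (ler_norm _) _; exact: disc_norm_le.
Qed.

Lemma ra_cost_norm_le xi t : 0 <= t -> `|ra_cost gamma l c xi t| <= B.
Proof.
move=> t0; have := run_max_norm_le xi t t0.
have := disc_norm_le _ t t0 (lB (xi t)).
rewrite !ler_norml /ra_cost ge_max le_max => /andP[_ ->] /andP[-> ->].
by rewrite orbT.
Qed.

Lemma ra_cost_ge xi t : 0 <= t -> - B <= ra_cost gamma l c xi t.
Proof. by move=> /(ra_cost_norm_le xi); rewrite ler_norml => /andP[]. Qed.

Lemma halfline_ge0 t : (`[0, +oo[%classic : set R) t -> 0 <= t.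
Proof. by rewrite /= in_itv/= andbT. Qed.

Lemma ge0_halfline t : 0 <= t -> (`[0, +oo[%classic : set R) t.
Proof. by rewrite /= in_itv/= andbT. Qed.

Lemma halfline_nonempty : (`[0, +oo[%classic : set R) !=set0.
Proof. by exists 0; exact: ge0_halfline. Qed.

Lemma cost_ge xi : - B <= cost xi.
Proof.
apply: inf_image_ge; first exact: halfline_nonempty.
by move=> t /halfline_ge0; exact: ra_cost_ge.
Qed.

Lemma cost_le_ra_cost xi t : 0 <= t -> cost xi <= ra_cost gamma l c xi t.
Proof.
move=> t0; apply: (@inf_image_le _ _ _ _ (- B)); last exact: ge0_halfline.
by move=> s /halfline_ge0; exact: ra_cost_ge.
Qed.

Lemma cost_le xi : cost xi <= B.
Proof.
apply: le_trans (cost_le_ra_cost xi 0 (lexx _)) _.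
by apply: le_trans (ler_norm _) _; exact: ra_cost_norm_le.
Qed.

Lemma eq_run_max xi eta t : (forall s, 0 <= s <= t -> xi s = eta s) ->
  run_max gamma c xi t = run_max gamma c eta t.
Proof.
move=> h; congr sup; apply: eq_imagel => s /=.
by rewrite in_itv/= => /h ->.
Qed.

Lemma eq_ra_cost xi eta t : 0 <= t -> (forall s, 0 <= s <= t -> xi s = eta s) ->
  ra_cost gamma l c xi t = ra_cost gamma l c eta t.
Proof.
by move=> t0 h; rewrite /ra_cost (eq_run_max _ _ _ h) h// t0 lexx.
Qed.

Lemma eq_cost xi eta : (forall s, 0 <= s -> xi s = eta s) -> cost xi = cost eta.
Proof.
move=> h; congr inf; apply: eq_imagel => t /halfline_ge0 t0.
by apply: eq_ra_cost => // s /andP[s0 _]; exact: h.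
Qed.

(** * Splitting the cost of a path at time [T] *)

Section split.
Variables (xi eta : R -> 'rV[R]_n) (T : R).
Hypothesis T0 : 0 <= T.
Hypothesis xi_eta : forall s, 0 <= s -> xi (s + T) = eta s.

(** Times up to [T] fall under the second argument; at later times the discount factors as [disc T]
    times that of the tail. *)
Lemma run_max_split t : 0 <= t -> run_max gamma c xi (t + T) =
  Num.max (disc T * run_max gamma c eta t) (run_max gamma c xi T).
Proof.
move=> t0; apply/le_anti/andP; split.
  apply: run_max_le => [|s /andP[s0 st]]; first exact: addr_ge0.
  rewrite le_max; have [sT|/ltW Ts] := leP s T.
    by rewrite (run_max_ge xi)// ?orbT// s0.
  have e : s = (s - T) + T by rewrite subrK.
  have sT0 : 0 <= s - T by rewrite subr_ge0.
  rewrite e discD xi_eta// -mulrA ler_wpM2l ?expR_ge0//.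
  by rewrite run_max_ge// sT0 lerBlDr.
rewrite ge_max; apply/andP; split; last first.
  apply: run_max_le => // s /andP[s0 sT]; apply: run_max_ge.
  by rewrite s0 (le_trans sT)// lerDr.
rewrite -ler_pdivlMl ?expR_gt0//; apply: run_max_le => // s /andP[s0 st].
rewrite ler_pdivlMl ?expR_gt0// mulrA -discD -xi_eta//.
by apply: run_max_ge; rewrite addr_ge0//= lerD2r.
Qed.

Lemma ra_cost_split t : 0 <= t -> ra_cost gamma l c xi (t + T) =
  Num.max (disc T * ra_cost gamma l c eta t) (run_max gamma c xi T).
Proof.
move=> t0; rewrite /ra_cost run_max_split// discD xi_eta// -mulrA maxA.
by rewrite maxr_pMr ?expR_ge0.
Qed.

(** The times up to [T] give the first argument of the minimum; the later ones give the second, by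
    [ra_cost_split]. *)
Lemma cost_split : cost xi =
  Num.min (inf [set ra_cost gamma l c xi t | t in `[0, T]])
    (Num.max (disc T * cost eta) (run_max gamma c xi T)).
Proof.
have T_ge0 t : (`[0, T]%classic : set R) t -> 0 <= t.
  by rewrite /= in_itv/= => /andP[].
apply/le_anti/andP; split.
  rewrite le_min; apply/andP; split.
    apply: inf_image_ge; first by exists 0; rewrite /= in_itv/= lexx.
    by move=> t /T_ge0; exact: cost_le_ra_cost.
  (* If both arguments of the maximum were below [cost xi], some tail time [t] would already make
     the discounted tail cost too small, and then [t + T] would beat the infimum. *)
  rewrite leNgt; apply/negP; rewrite gt_max => /andP[+ rm].
  rewrite -ltr_pdivlMl ?expR_gt0// => /inf_image_lt => /(_ (- B)).
  case; first exact: halfline_nonempty.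
    by move=> t /halfline_ge0; exact: ra_cost_ge.
  move=> t /halfline_ge0 t0; rewrite ltr_pdivlMl ?expR_gt0// => ht.
  have := cost_le_ra_cost xi (t + T) (addr_ge0 t0 T0).
  by rewrite ra_cost_split// leNgt gt_max ht rm.
apply: inf_image_ge; first exact: halfline_nonempty.
move=> t /halfline_ge0 t0; rewrite ge_min; have [tT|/ltW Tt] := leP t T.
  apply/orP; left; apply: (@inf_image_le _ _ _ _ (- B)).
    by move=> s /T_ge0; exact: ra_cost_ge.
  by rewrite /= in_itv/= t0.
have tT0 : 0 <= t - T by rewrite subr_ge0.
apply/orP; right; rewrite -(subrK T t) ra_cost_split//.
rewrite ge_max !le_max lexx orbT andbT ler_wpM2l ?expR_ge0//.
exact: cost_le_ra_cost.
Qed.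

End split.
End cost.

(** Minimum and maximum are monotone and 1-Lipschitz, and [d <= 1], so a loss of [e] in [b] costs at
    most [e] overall. *)
Lemma min_max_perturb {R : realType} (a b b' r d e : R) : 0 <= d <= 1 -> 0 <= e ->
  b - e <= b' ->
  Num.min a (Num.max (d * b) r) - e <= Num.min a (Num.max (d * b') r).
Proof.
move=> /andP[d0 d1] e0 bb'.
have h : d * b - e <= d * b'.
  apply: (@le_trans _ _ (d * (b - e))); last by rewrite ler_wpM2l.
  by rewrite mulrBr lerD2l lerN2 -[leRHS]mul1r ler_wpM2r.
rewrite le_min !lerBlDr; apply/andP; split.
  by rewrite ge_min lerDl e0.
rewrite ge_min ge_max; apply/orP; right; apply/andP; split.
  by rewrite -lerBlDr le_max h.
by rewrite -lerBlDr le_max gerBl e0 orbT.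
Qed.

(** * Trajectories *)

Section game.
Context {R : realType} {n mu md : nat}.
Variables (U : set 'rV[R]_mu) (D : set 'rV[R]_md).
Variable f : 'rV[R]_n -> 'rV[R]_mu -> 'rV[R]_md -> 'rV[R]_n.
Variables M L : R.
Hypothesis hf_uc : forall e : R, 0 < e -> exists2 delta : R, 0 < delta &
  forall x x' u u' d d', U u -> U u' -> D d -> D d' ->
    `|x - x'| < delta -> `|u - u'| < delta -> `|d - d'| < delta ->
    `|f x u d - f x' u' d'| < e.
Hypothesis M0 : 0 <= M.
Hypothesis hf_bd : forall x u d, U u -> D d -> `|f x u d| <= M.
Hypothesis L1 : 1 <= L.
Hypothesis hf_lip : forall x y u d, U u -> D d ->
  `|f x u d - f y u d| <= L * `|x - y|.

Implicit Types (u : R -> 'rV[R]_mu) (d : R -> 'rV[R]_md) (xi eta : R -> 'rV[R]_n).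

Definition rhs u d xi i (s : R) : R := f (xi s) (u s) (d s) 0 i.

Lemma rhs_le u d xi i s : admissible U u -> admissible D d -> 0 <= s ->
  `|rhs u d xi i s| <= M.
Proof.
move=> [Uu _] [Dd _] s0; apply: le_trans (coord_le_norm _ i) _.
exact: hf_bd (Uu _ s0) (Dd _ s0).
Qed.

(** Uniform continuity of [f] composed with a continuous state and measurable inputs gives
    measurability; [hf_bd] gives the bound. *)
Lemma lbm_rhs u d xi i : admissible U u -> admissible D d ->
  {within `[0, +oo[, continuous xi} -> loc_bounded_meas (rhs u d xi i).
Proof.
move=> au ad cxi; split; last first.
  by move=> t; exists M => s /andP[s0 _]; exact: rhs_le.
apply: (@measurable_continuous_comp3 _ (LebR R) R (`[0, +oo[ : set (LebR R))
  _ _ _ _ xi u d (fun x y z => f x y z 0 i)).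
- exact: measurable_itv_LebR.
- by move=> j; exact: measurable_within_continuous.
- by move=> j; case: au.
- by move=> j; case: ad.
- move=> e /hf_uc[delta d0 h]; exists delta => // s s'.
  rewrite /= !in_itv/= !andbT => s0 s'0 h1 h2 h3.
  apply: le_lt_trans (h _ _ _ _ _ _ _ _ _ _ h1 h2 h3).
  + by apply: le_trans (coord_le_norm _ i); rewrite !mxE.
  + by case: au => + _; exact.
  + by case: au => + _; exact.
  + by case: ad => + _; exact.
  + by case: ad => + _; exact.
Qed.

(** With this rate, the integral of [L * expR (K * s)] up to [t] is at most half of
    [expR (K * t)]. *)
Let K := 2 * L.

Lemma lbm_expR (a : R) : loc_bounded_meas (fun s => a * expR (a * s)).
Proof. exact: lbm_continuous (continuous_expRM a). Qed.

(* In the norm weighted by [expR (- K * t)] the Picard operator contracts by [1/2]. *)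
Lemma rhs_contract u d xi eta i t A : admissible U u -> admissible D d ->
  {within `[0, +oo[, continuous xi} -> {within `[0, +oo[, continuous eta} ->
  0 <= t -> 0 <= A ->
  (forall s, 0 <= s <= t -> `|xi s - eta s| <= A * expR (K * s)) ->
  `|prim (rhs u d xi i) t - prim (rhs u d eta i) t| <= A / 2 * expR (K * t).
Proof.
move=> au ad cxi ceta t0 A0 h.
rewrite -primB; [|exact: lbm_rhs..].
apply: (@le_trans _ _ (prim (fun s => A / 2 * (K * expR (K * s))) t)).
  apply: le_norm_prim.
  - by apply: lbmB; exact: lbm_rhs.
  - exact: lbm_scale (lbm_expR K).
  move=> s /andP[s0 st]; rewrite /= /rhs.
  have -> : A / 2 * (K * expR (K * s)) = L * (A * expR (K * s)).
    by rewrite /K; field.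
  apply: (@le_trans _ _ `|f (xi s) (u s) (d s) - f (eta s) (u s) (d s)|).
    by apply: le_trans (coord_le_norm _ i); rewrite !mxE.
  apply: le_trans (hf_lip _ _ _ _ _ _) _; first by case: au => + _; exact.
    by case: ad => + _; exact.
  by rewrite ler_wpM2l ?(le_trans _ L1)// h// s0.
rewrite prim_scale; last exact: lbm_expR.
rewrite prim_expR// ler_wpM2l ?divr_ge0//.
by rewrite gerBl.
Qed.

(** Absorbs the linear a priori bounds into the exponential weight at the start of the inductions
    below; this is where [1 <= L] enters. *)
Lemma linear_le_expR t : 0 <= t -> 2 * t <= expR (K * t).
Proof.
move=> t0; apply: le_trans (expR_ge1Dx _); rewrite /K.
have : 0 <= (L - 1) * t by rewrite mulr_ge0// subr_ge0.
lra.
Qed.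

Lemma solution_lipschitz x u d xi s t : admissible U u -> admissible D d ->
  is_solution f x u d xi -> 0 <= s -> 0 <= t -> `|xi s - xi t| <= M * `|s - t|.
Proof.
move=> au ad [_ [cxi h]] s0 t0; apply: norm_le_coord; first exact: mulr_ge0.
move=> i; rewrite !mxE (h s s0 i) (h t t0 i) opprD addrACA subrr add0r.
apply: prim_lipschitz s0 t0; first exact: lbm_rhs.
by move=> r r0; exact: rhs_le.
Qed.

(** Starting from the a priori bound [M * (2 * t)], each use of the contraction halves the weighted
    distance. Working on a bounded horizon also yields that the state does not anticipate the
    controls. *)
Lemma solution_unique x u u' d d' xi eta T :
  admissible U u -> admissible U u' -> admissible D d -> admissible D d' ->
  {ae leb, forall s : LebR R, `[0, T] s -> u s = u' s} ->
  {ae leb, forall s : LebR R, `[0, T] s -> d s = d' s} ->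
  is_solution f x u d xi -> is_solution f x u' d' eta ->
  forall t, 0 <= t <= T -> xi t = eta t.
Proof.
move=> au au' ad ad' uu' dd' sxi seta.
have [x0 [cxi hxi]] := sxi; have [eta0 [ceta heta]] := seta.
have bound k t : 0 <= t <= T -> `|xi t - eta t| <= M / 2 ^+ k * expR (K * t).
  elim: k t => [|k IH] t /andP[t0 tT].
    rewrite expr0 divr1; apply: (@le_trans _ _ (M * (2 * t))); last first.
      by rewrite ler_wpM2l// linear_le_expR.
    have -> : xi t - eta t = (xi t - xi 0) - (eta t - eta 0).
      by rewrite x0 eta0 opprB addrA subrK.
    apply: le_trans (ler_normB _ _) _.
    have := solution_lipschitz _ _ _ _ t 0 au ad sxi t0 (lexx 0).
    have := solution_lipschitz _ _ _ _ t 0 au' ad' seta t0 (lexx 0).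
    rewrite subr0 ger0_norm// => h1 h2; apply: le_trans (lerD h2 h1) _.
    by rewrite mulrCA mulr2n mulrDl mul1r.
  apply: norm_le_coord.
    by rewrite mulr_ge0 ?expR_ge0// divr_ge0// exprn_ge0.
  move=> i; rewrite !mxE (hxi t t0 i) (heta t t0 i) opprD addrACA subrr add0r.
  (* Both integrals are put under the same controls, which changes the integrand only on a null
     set. *)
  have -> : Rintegral leb (`[0, t] : set (LebR R)) (fun s => f (eta s) (u' s) (d' s) 0 i) =
      prim (rhs u d eta i) t.
    apply: eq_prim; [exact: lbm_rhs..|].
    apply: filterS2 uu' dd' => s /= h1 h2.
    rewrite in_itv/= => /andP[s0 st].
    have sT : (`[0, T]%classic : set R) s by rewrite /= in_itv/= s0 (le_trans st).
    by rewrite /rhs (h1 sT) (h2 sT).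
  rewrite exprSr invfM mulrA; apply: rhs_contract => //.
    by rewrite divr_ge0// exprn_ge0.
  by move=> s /andP[s0 st]; apply: IH; rewrite s0 (le_trans st).
move=> t tT; apply/eqP; rewrite -subr_eq0 -normr_le0.
apply: (@le0_geometric _ _ (M * expR (K * t))) => k.
by rewrite mulrAC; exact: bound.
Qed.

(** * Existence of solutions by Picard iteration *)

Fixpoint picard x u d k : R -> 'rV[R]_n :=
  if k is k'.+1 then
    fun t => \row_i (x 0 i + prim (rhs u d (picard x u d k') i) t)
  else fun=> x.

Section existence.
Variables (x : 'rV[R]_n) (u : R -> 'rV[R]_mu) (d : R -> 'rV[R]_md).
Hypotheses (au : admissible U u) (ad : admissible D d).

Let X := picard x u d.

(** The constant is the same for all iterates, so the limit inherits it. *)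
Lemma picard_lipschitz k s t : 0 <= s -> 0 <= t -> `|X k s - X k t| <= M * `|s - t|.
Proof.
elim: k s t => [|k IH] s t s0 t0; first by rewrite /X/= subrr normr0 mulr_ge0.
apply: norm_le_coord; first exact: mulr_ge0.
move=> i; rewrite !mxE opprD addrACA subrr add0r.
apply: prim_lipschitz s0 t0; last by move=> r r0; exact: rhs_le.
by apply: lbm_rhs => //; exact: lipschitz_within_continuous M0 IH.
Qed.

Lemma picard_continuous k : {within `[0, +oo[, continuous (X k)}.
Proof. exact: lipschitz_within_continuous M0 (picard_lipschitz k). Qed.

Lemma picard_step k t : 0 <= t ->
  `|X k.+1 t - X k t| <= M / 2 ^+ k * expR (K * t).
Proof.
elim: k t => [|k IH] t t0.
  rewrite expr0 divr1; apply: norm_le_coord; first by rewrite mulr_ge0 ?expR_ge0.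
  move=> i; rewrite !mxE addrAC subrr add0r.
  apply: (@le_trans _ _ (M * (2 * t))); last by rewrite ler_wpM2l// linear_le_expR.
  apply: (@le_trans _ _ (M * t)); last first.
    by rewrite ler_wpM2l// mulr2n mulrDl mul1r lerDl.
  rewrite -(prim_cst M _ t0); apply: le_norm_prim.
  - by apply: lbm_rhs => //; exact: (picard_continuous 0).
  - exact: lbm_cst.
  - by move=> s /andP[s0 _]; exact: rhs_le.
apply: norm_le_coord; first by rewrite mulr_ge0 ?expR_ge0// divr_ge0// exprn_ge0.
move=> i; rewrite [X k.+2 t]/= [X k.+1 t]/= !mxE opprD addrACA subrr add0r.
rewrite exprSr invfM mulrA.
apply: (rhs_contract u d (X k.+1) (X k) i t (M / 2 ^+ k)) => //.
- exact: picard_continuous.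
- exact: picard_continuous.
- by rewrite divr_ge0// exprn_ge0.
- by move=> s /andP[s0 _]; exact: IH.
Qed.

(** [nested_limit] at each time and coordinate. The radius is twice the step bound, so that
    consecutive radii differ exactly by that bound. *)
Lemma picard_limit : exists xi, forall t, 0 <= t -> forall k,
  `|X k t - xi t| <= 2 * M / 2 ^+ k * expR (K * t).
Proof.
have r0 t k : 0 <= 2 * M / 2 ^+ k * expR (K * t).
  by rewrite mulr_ge0 ?expR_ge0// divr_ge0 ?exprn_ge0// mulr_ge0.
(* One choice over pairs of a time and a coordinate; negative times receive the default 0. *)
have h (ti : R * 'I_n) : exists l, 0 <= ti.1 -> forall k,
    `|X k ti.1 0 ti.2 - l| <= 2 * M / 2 ^+ k * expR (K * ti.1).
  case: ti => t i /=; have [t0|_] := boolP (0 <= t); last by exists 0.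
  have [|l hl] := @nested_limit _ (fun k => X k t 0 i) _ (r0 t).
    move=> k; apply: (@le_trans _ _ (M / 2 ^+ k * expR (K * t))).
      apply: le_trans (picard_step _ _ t0).
      by apply: le_trans (coord_le_norm _ i); rewrite !mxE.
    have -> : 2 * M / 2 ^+ k.+1 = M / 2 ^+ k.
      by rewrite exprS; field; rewrite expf_neq0.
    have -> : 2 * M / 2 ^+ k * expR (K * t) = 2 * (M / 2 ^+ k * expR (K * t)).
      by rewrite !mulrA.
    by move: (M / _ * _) => y; lra.
  by exists l.
have [l hl] := choice h.
exists (fun t => \row_i l (t, i)) => t t0 k; apply: norm_le_coord => // i.
by rewrite !mxE; exact: (hl (t, i)).
Qed.

Lemma solution_exists : exists xi, is_solution f x u d xi.
Proof.
have [xi hxi] := picard_limit.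
have cxi : {within `[0, +oo[, continuous xi}.
  apply: (lipschitz_within_continuous _ _ M0) => s t s0 t0.
  (* The excess over [M * |s - t|] is at most the sum of the distances to the [k]-th iterate at both
     times, for every [k]. *)
  rewrite -subr_le0.
  apply: (@le0_geometric _ _ (2 * M * expR (K * s) + 2 * M * expR (K * t))) => k.
  have -> : (2 * M * expR (K * s) + 2 * M * expR (K * t)) / 2 ^+ k =
      2 * M / 2 ^+ k * expR (K * s) + 2 * M / 2 ^+ k * expR (K * t).
    by rewrite mulrDl !(mulrAC _ (expR _)).
  have := hxi s s0 k; have := hxi t t0 k.
  move: (_ * expR (K * s)) (_ * expR (K * t)) => p q.
  have := picard_lipschitz k s t s0 t0.
  have := ler_distD (X k s) (xi s) (xi t).
  have := ler_distD (X k t) (X k s) (xi t).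
  rewrite (distrC (xi s) (X k s)); move: (M * `|s - t|) => r.
  lra.
have eqn t : 0 <= t -> forall i, xi t 0 i = x 0 i + prim (rhs u d xi i) t.
  move=> t0 i; apply/eqP; rewrite -subr_eq0 -normr_le0.
  (* The defect in the equation is split into the distance from [xi] to iterate [k + 1] and the
     distance between the integrals along iterate [k] and along [xi], each at most
     [M / 2 ^+ k * expR (K * t)]. *)
  apply: (@le0_geometric _ _ (2 * M * expR (K * t))) => k.
  have h1 : `|X k.+1 t 0 i - xi t 0 i| <= M / 2 ^+ k * expR (K * t).
    have := hxi t t0 k.+1.
    have -> : 2 * M / 2 ^+ k.+1 = M / 2 ^+ k.
      by rewrite exprS; field; rewrite expf_neq0.
    by apply: le_trans; apply: le_trans (coord_le_norm _ i); rewrite !mxE.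
  have h2 : `|prim (rhs u d (X k) i) t - prim (rhs u d xi i) t| <=
      M / 2 ^+ k * expR (K * t).
    have -> : M / 2 ^+ k = 2 * M / 2 ^+ k / 2 by field; rewrite expf_neq0.
    apply: rhs_contract => //; first exact: picard_continuous.
      by rewrite divr_ge0 ?exprn_ge0// mulr_ge0.
    by move=> s /andP[s0 _]; exact: hxi.
  move: h1; rewrite [X k.+1 t]/= mxE -/X => h1.
  rewrite mulrAC.
  have -> : 2 * M / 2 ^+ k * expR (K * t) =
    M / 2 ^+ k * expR (K * t) + M / 2 ^+ k * expR (K * t).
    by rewrite -2!mulrA mulr2n mulrDl mul1r !mulrA.
  move: h1 h2; rewrite !ler_norml; lra.
exists xi; split; last by split.
apply/rowP => i; rewrite (eqn 0 (lexx 0) i) prim0 ?addr0//; exact: lbm_rhs.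
Qed.

End existence.

(** * Dependence of trajectories on the controls, and restart at time [T] *)

Lemma traj_solution x u d : admissible U u -> admissible D d ->
  is_solution f x u d (traj f x u d).
Proof.
move=> au ad; rewrite /traj; case: pselect => [h|]; first by case: cid.
(* Existence rules out the default branch of [traj]. *)
by case; exact: solution_exists.
Qed.

Lemma traj_local x u u' d d' T :
  admissible U u -> admissible U u' -> admissible D d -> admissible D d' ->
  {ae leb, forall s : LebR R, `[0, T] s -> u s = u' s} ->
  {ae leb, forall s : LebR R, `[0, T] s -> d s = d' s} ->
  forall t, 0 <= t <= T -> traj f x u d t = traj f x u' d' t.
Proof.
move=> au au' ad ad' uu' dd'.
by apply: solution_unique uu' dd' _ _ => //; exact: traj_solution.
Qed.

Lemma traj_eq x u u' d d' :
  admissible U u -> admissible U u' -> admissible D d -> admissible D d' ->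
  (forall s, 0 <= s -> u s = u' s) -> (forall s, 0 <= s -> d s = d' s) ->
  forall t, 0 <= t -> traj f x u d t = traj f x u' d' t.
Proof.
move=> au au' ad ad' uu' dd' t t0.
apply: (traj_local _ _ _ _ _ t) => //; last by rewrite t0 lexx.
- by apply: aeW => s /=; rewrite in_itv/= => /andP[s0 _]; exact: uu'.
- by apply: aeW => s /=; rewrite in_itv/= => /andP[s0 _]; exact: dd'.
Qed.

(** By [prim_split], the translated path solves the equation restarted at the state reached at [T];
    uniqueness identifies it. *)
Lemma traj_translate x u d T : admissible U u -> admissible D d -> 0 <= T ->
  forall t, 0 <= t -> traj f x u d (t + T) =
    traj f (traj f x u d T) (u \o translate T) (d \o translate T) t.
Proof.
move=> au ad T0 t t0; set xi := traj f x u d.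
have aut := admissible_translate _ _ _ _ T0 au.
have adt := admissible_translate _ _ _ _ T0 ad.
have sxi : is_solution f x u d xi by exact: traj_solution.
have [x0 [cxi hxi]] := sxi.
have seta : is_solution f (xi T) (u \o translate T) (d \o translate T)
    (xi \o translate T).
  split; first by rewrite /= /translate add0r.
  split.
    apply: (lipschitz_within_continuous _ _ M0) => r s r0 s0.
    rewrite /= /translate.
    have := solution_lipschitz _ _ _ _ (r + T) (s + T) au ad sxi.
    by rewrite opprD addrACA subrr addr0; apply; rewrite addr_ge0.
  move=> s s0 i; rewrite (hxi T T0 i) /= /translate (hxi (s + T)) ?addr_ge0//.
  rewrite -addrA; congr (_ + _); rewrite (addrC s T).
  by apply: (prim_split (rhs u d xi i)) => //; exact: lbm_rhs.
apply: (solution_unique (xi T) _ _ _ _ (xi \o translate T) _ t aut aut adt adt).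
- by apply: aeW.
- by apply: aeW.
- exact: seta.
- exact: traj_solution.
- by rewrite t0 lexx.
Qed.

(** * Dynamic programming *)

Variables (l c : 'rV[R]_n -> R) (gamma B : R).
Hypothesis gamma0 : 0 <= gamma.
Hypothesis lB : forall x, `|l x| <= B.
Hypothesis cB : forall x, `|c x| <= B.
Variables (u0 : 'rV[R]_mu) (d0 : 'rV[R]_md).
Hypotheses (Uu0 : U u0) (Dd0 : D d0).
Variable T : R.
Hypothesis T0 : 0 <= T.

Local Notation control := (R -> 'rV[R]_mu).
Local Notation strategy := (control -> R -> 'rV[R]_md).
Local Notation strat := (nonanticipative_strategy U D).
Local Notation J x u d := (cost gamma l c (traj f x u d)).
Local Notation V := (V_gamma f U D l c gamma).
Local Notation disc t := (expR (- (gamma * t))).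

Definition guaranteed x (lam : strategy) : R :=
  inf [set J x u (lam u) | u in admissible U].

(** The right-hand side of [cost_split] with the cost of the tail replaced by the value at the state
    reached at [T]. *)
Definition truncated_cost (xi : R -> 'rV[R]_n) : R :=
  Num.min (inf [set ra_cost gamma l c xi t | t in `[0, T]])
    (Num.max (disc T * V (xi T)) (run_max gamma c xi T)).

Definition truncated_guaranteed x (lam : strategy) : R :=
  inf [set truncated_cost (traj f x u (lam u)) | u in admissible U].

Lemma V_sup x : V x = sup [set guaranteed x lam | lam in strat].
Proof. by []. Qed.

Lemma admissible_nonempty : admissible U !=set0.
Proof. by exists (fun=> u0); exact: admissible_cst. Qed.

Lemma strategy_nonempty : strat !=set0.
Proof.
exists (fun=> fun=> d0); split=> [u _|u u' _ _ t t0 _].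
  exact: admissible_cst.
exact: aeW.
Qed.

Lemma guaranteed_le_cost x lam u : admissible U u -> guaranteed x lam <= J x u (lam u).
Proof.
move=> au; apply: (@inf_image_le _ _ (fun u => J x u (lam u)) _ (- B)) => // v _.
exact: cost_ge.
Qed.

Lemma guaranteed_ge x lam : - B <= guaranteed x lam.
Proof.
apply: inf_image_ge; first exact: admissible_nonempty.
by move=> u _; exact: cost_ge.
Qed.

Lemma guaranteed_le x lam : guaranteed x lam <= B.
Proof.
have [u au] := admissible_nonempty.
by apply: le_trans (guaranteed_le_cost _ _ _ au) _; exact: cost_le.
Qed.

Lemma guaranteed_le_V x lam : strat lam -> guaranteed x lam <= V x.
Proof.
move=> sl; rewrite V_sup; apply: (@sup_image_ge _ _ _ _ B) => // lam' _.
exact: guaranteed_le.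
Qed.

(** Makes the truncated cost bounded, so that the suprema and infima over it behave as expected. *)
Lemma V_norm_le x : `|V x| <= B.
Proof.
rewrite ler_norml; apply/andP; split.
  have [lam sl] := strategy_nonempty.
  by apply: le_trans (guaranteed_le_V _ _ sl); exact: guaranteed_ge.
rewrite V_sup; apply: sup_image_le; first exact: strategy_nonempty.
by move=> lam _; exact: guaranteed_le.
Qed.

Lemma inf_ra_cost_norm_le (xi : R -> 'rV[R]_n) :
  `|inf [set ra_cost gamma l c xi t | t in `[0, T]]| <= B.
Proof.
have h t : (`[0, T]%classic : set R) t -> `|ra_cost gamma l c xi t| <= B.
  by rewrite /= in_itv/= => /andP[t0 _]; exact: ra_cost_norm_le.
have z : (`[0, T]%classic : set R) 0 by rewrite /= in_itv/= lexx.
rewrite ler_norml; apply/andP; split.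
  apply: inf_image_ge; first by exists 0.
  by move=> t /h; rewrite ler_norml => /andP[].
apply: (@le_trans _ _ (ra_cost gamma l c xi 0)).
  apply: (@inf_image_le _ _ _ _ (- B)) => // t /h.
  by rewrite ler_norml => /andP[].
exact: le_trans (ler_norm _) (h _ z).
Qed.

Lemma truncated_cost_norm_le xi : `|truncated_cost xi| <= B.
Proof.
have := inf_ra_cost_norm_le xi.
have := @run_max_norm_le _ _ gamma c B gamma0 cB xi T T0.
have := @disc_norm_le _ gamma B gamma0 _ T T0 (V_norm_le (xi T)).
rewrite !ler_norml => /andP[a1 a2] /andP[b1 b2] /andP[e1 e2].
by rewrite /truncated_cost le_min e1 le_max a1 ge_min e2.
Qed.

Lemma truncated_guaranteed_le_cost x lam u : admissible U u ->
  truncated_guaranteed x lam <= truncated_cost (traj f x u (lam u)).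
Proof.
move=> au.
apply: (@inf_image_le _ _ (fun u => truncated_cost (traj f x u (lam u))) _ (- B)) => // v _.
by have := truncated_cost_norm_le (traj f x v (lam v)); rewrite ler_norml => /andP[].
Qed.

Lemma truncated_guaranteed_le x lam : truncated_guaranteed x lam <= B.
Proof.
have [u au] := admissible_nonempty.
apply: le_trans (truncated_guaranteed_le_cost _ _ _ au) _.
exact: le_trans (ler_norm _) (truncated_cost_norm_le _).
Qed.

Lemma cost_dpp x u d : admissible U u -> admissible D d -> J x u d =
  Num.min (inf [set ra_cost gamma l c (traj f x u d) t | t in `[0, T]])
    (Num.max (disc T * J (traj f x u d T) (u \o translate T) (d \o translate T))
      (run_max gamma c (traj f x u d) T)).
Proof.
move=> au ad; apply: (@cost_split _ _ _ _ _ B) => //.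
by move=> s s0; rewrite traj_translate.
Qed.

(** The answer of [lam] after [T] once [u] has been played up to [T]. *)
Definition shifted_strategy (u : control) (lam : strategy) : strategy :=
  fun v => lam (concat T u v) \o translate T.

Lemma shifted_strategyP u lam : admissible U u -> strat lam ->
  strat (shifted_strategy u lam).
Proof.
move=> au [al nl]; split=> [v av|v v' av av' t t0 vv'].
  by apply: admissible_translate T0 _; apply: al; exact: admissible_concat.
have av1 := admissible_concat _ _ _ _ _ T0 au av.
have av1' := admissible_concat _ _ _ _ _ T0 au av'.
(* Before [T] both concatenations equal [u]; afterwards they agree by the hypothesis on [v] and
   [v'], moved forward by [T]. *)
have h : {ae leb, forall s : LebR R, `[0, t + T] s -> concat T u v s = concat T u v' s}.
  apply: ae_mono (ae_translate (- T) _ vv') => s hs /=.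
  rewrite in_itv/= => /andP[s0 st]; rewrite /concat; case: ltP => // Ts.
  by apply: hs; rewrite /= in_itv/= /translate subr_ge0 Ts lerBlDr.
have := ae_translate T _ (nl _ _ av1 av1' _ (addr_ge0 t0 T0) h).
apply: ae_mono => s hs /=; rewrite in_itv/= => /andP[s0 st].
by apply: hs; rewrite /= in_itv/= /translate addr_ge0//= lerD2r.
Qed.

Lemma guaranteed_le_truncated x lam u : strat lam -> admissible U u ->
  guaranteed x lam <= truncated_cost (traj f x u (lam u)).
Proof.
move=> sl au; have [al nl] := sl; set xi := traj f x u (lam u).
rewrite le_min; apply/andP; split.
  apply: le_trans (guaranteed_le_cost _ _ _ au) _.
  by rewrite (cost_dpp _ _ _ au (al _ au)) ge_min lexx.
(* Otherwise the shifted strategy guarantees too little at [xi T], so some [v] has a small tail cost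
   against it, and playing [u] then [v] undercuts what [lam] guarantees at [x]. *)
rewrite leNgt; apply/negP; rewrite gt_max => /andP[hV hrm].
have slT := shifted_strategyP _ _ au sl.
have : guaranteed (xi T) (shifted_strategy u lam) < (disc T)^-1 * guaranteed x lam.
  by apply: le_lt_trans (guaranteed_le_V _ _ slT) _; rewrite ltr_pdivlMl ?expR_gt0.
move=> /inf_image_lt => /(_ (- B)); case; first exact: admissible_nonempty.
  by move=> v _; exact: cost_ge.
move=> v av; rewrite ltr_pdivlMl ?expR_gt0// => hv.
set w := concat T u v; have aw : admissible U w by exact: admissible_concat.
have wu : {ae leb, forall s : LebR R, `[0, T] s -> w s = u s} by exact: ae_concat.
(* Since [lam] is non-anticipative, replacing [u] by [w] leaves its answer up to [T] unchanged
   almost everywhere. *)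
have eqT s : 0 <= s <= T -> traj f x w (lam w) s = xi s.
  apply: (traj_local _ _ _ _ _ T aw au (al _ aw) (al _ au) wu).
  exact: (nl _ _ aw au T T0 wu).
have := guaranteed_le_cost x lam _ aw; apply/negP; rewrite -ltNge.
rewrite (cost_dpp _ _ _ aw (al _ aw)) gt_min; apply/orP; right.
rewrite (eq_run_max _ _ _ _ _ eqT) (eqT T) ?T0 ?lexx// gt_max hrm andbT.
rewrite (_ : J _ _ _ = J (xi T) v (shifted_strategy u lam v)); first exact: hv.
have awT := admissible_translate _ _ _ _ T0 aw.
have alT := admissible_translate _ _ _ _ T0 (al _ aw).
apply: eq_cost => s; apply: (traj_eq _ _ _ _ _ awT av alT alT).
  by move=> r r0; rewrite concat_translate.
by [].
Qed.

(** The state at [T] depends on [u] only through its past, so selecting the continuation from that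
    state respects non-anticipation. *)
Definition glued_strategy x (lam : strategy) (lam' : 'rV[R]_n -> strategy) : strategy :=
  fun u => concat T (lam u) (lam' (traj f x u (lam u) T) (u \o translate T)).

Lemma glued_strategyP x lam lam' : strat lam -> (forall y, strat (lam' y)) ->
  strat (glued_strategy x lam lam').
Proof.
move=> [al nl] sl'; split=> [u au|u u' au au' t t0 uu'].
  apply: admissible_concat T0 (al _ au) _.
  by case: (sl' (traj f x u (lam u) T)) => + _; apply; exact: admissible_translate.
(* When [t < T] only [lam] is in play. *)
have [Tt|tT] := leP T t; last first.
  apply: ae_mono (nl _ _ au au' _ t0 uu') => s hs st.
  rewrite /glued_strategy /concat ifT; last first.
    by move: st; rewrite /= in_itv/= => /andP[_ /le_lt_trans]; apply.
  rewrite ifT; first exact: hs.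
  by move: st; rewrite /= in_itv/= => /andP[_ /le_lt_trans]; apply.
have sub (X : Type) (g g' : R -> X) :
    {ae leb, forall s : LebR R, `[0, t] s -> g s = g' s} ->
    {ae leb, forall s : LebR R, `[0, T] s -> g s = g' s}.
  apply: ae_mono => s hs /=; rewrite in_itv/= => /andP[s0 sT]; apply: hs.
  by rewrite /= in_itv/= s0 (le_trans sT).
have lamt := nl _ _ au au' _ t0 uu'.
(* Both controls lead to the same state at [T], hence to the same continuation strategy. *)
have yy' : traj f x u (lam u) T = traj f x u' (lam u') T.
  apply: (traj_local _ _ _ _ _ T au au' (al _ au) (al _ au') (sub _ _ _ uu')
    (sub _ _ _ lamt)).
  by rewrite T0 lexx.
have tT0 : 0 <= t - T by rewrite subr_ge0.
have uuT : {ae leb, forall s : LebR R, `[0, t - T] s ->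
    (u \o translate T) s = (u' \o translate T) s}.
  apply: ae_mono (ae_translate T _ uu') => s hs /=; rewrite in_itv/= => /andP[s0 st].
  by apply: hs; rewrite /= in_itv/= /translate addr_ge0//= -lerBrDr.
have [_ nl'] := sl' (traj f x u (lam u) T).
have := nl' _ _ (admissible_translate _ _ _ _ T0 au)
  (admissible_translate _ _ _ _ T0 au') _ tT0 uuT.
move=> /(ae_translate (- T)).
apply: ae_mono2 lamt => s h1 h2 st; rewrite /glued_strategy -yy' /concat.
case: ltP => Ts; first exact: h1.
apply: h2; move: st; rewrite /= !in_itv/= => /andP[s0 st].
by rewrite /translate subr_ge0 Ts lerD2r.
Qed.

Lemma truncated_guaranteed_le_V x lam : strat lam ->
  truncated_guaranteed x lam <= V x.
Proof.
move=> sl; have [al nl] := sl; apply/ler_addgt0Pl => e e0.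
(* An [e]-optimal strategy for every possible state, gathered into one function by the axiom of
   choice. *)
have h y : exists lam', strat lam' /\ V y - e < guaranteed y lam'.
  have [|lam' sl' hl'] := @sup_image_adherent _ _ (guaranteed y) strat B e
    strategy_nonempty _ e0.
    by move=> lam' _; exact: guaranteed_le.
  by exists lam'.
have [lam' hl'] := choice h.
have sl' y : strat (lam' y) by case: (hl' y).
have sg := glued_strategyP x _ _ sl sl'.
rewrite -lerBlDl; apply: le_trans (guaranteed_le_V x _ sg).
apply: inf_image_ge; first exact: admissible_nonempty.
move=> u au; set xi := traj f x u (lam u).
have [ag _] := sg; have aug := ag u au.
have eqT s : 0 <= s <= T -> traj f x u (glued_strategy x lam lam' u) s = xi s.
  apply: (traj_local _ _ _ _ _ T au au aug (al _ au)); first exact: aeW.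
  exact: ae_concat.
have auT := admissible_translate _ _ _ _ T0 au.
have augT := admissible_translate _ _ _ _ T0 aug.
have alT : admissible D (lam' (xi T) (u \o translate T)).
  exact: (proj1 (sl' (xi T)) _ auT).
(* After [T] the glued strategy answers as the strategy selected for [xi T]. *)
have JE : J (xi T) (u \o translate T) (glued_strategy x lam lam' u \o translate T) =
    J (xi T) (u \o translate T) (lam' (xi T) (u \o translate T)).
  apply: eq_cost => s; apply: (traj_eq _ _ _ _ _ auT auT augT alT); first by [].
  exact: concat_translate.
have TT : 0 <= T <= T by rewrite T0 lexx.
rewrite (cost_dpp _ _ _ au aug) (eq_run_max _ _ _ _ _ eqT) (eqT T TT).
rewrite JE (_ : inf _ = inf [set ra_cost gamma l c xi t | t in `[0, T]]); last first.
  congr inf; apply: eq_imagel => t /=; rewrite in_itv/= => /andP[t0 tT].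
  apply: (eq_ra_cost _ _ _ _ _ _ t0) => s /andP[s0 st]; apply: eqT.
  by rewrite s0 (le_trans st tT).
apply: (@le_trans _ _ (truncated_cost xi - e)).
  by rewrite lerD2r; exact: truncated_guaranteed_le_cost.
(* The two sides differ only in the tail value, where the loss [e] is discounted by a factor at most
   1. *)
apply: min_max_perturb (ltW e0) _.
  by rewrite expR_ge0 (disc_le1 _ gamma0 _ T0).
apply: le_trans (guaranteed_le_cost _ _ _ auT).
exact: ltW (proj2 (hl' (xi T))).
Qed.

Lemma V_dpp x : V x = sup [set truncated_guaranteed x lam | lam in strat].
Proof.
apply/le_anti/andP; split; last first.
  apply: sup_image_le; first exact: strategy_nonempty.
  by move=> lam; exact: truncated_guaranteed_le_V.
rewrite V_sup; apply: sup_image_le; first exact: strategy_nonempty.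
move=> lam sl; apply: (@le_trans _ _ (truncated_guaranteed x lam)).
  apply: inf_image_ge; first exact: admissible_nonempty.
  by move=> u; exact: guaranteed_le_truncated.
apply: (@sup_image_ge _ _ _ _ B) => // lam' _; exact: truncated_guaranteed_le.
Qed.

End game.

(** * The dynamic programming principle under the standing assumptions *)

Theorem mainTheorem3 (R : realType) (n mu md : nat)
    (U : set 'rV[R]_mu) (D : set 'rV[R]_md)
    (f : 'rV[R]_n -> 'rV[R]_mu -> 'rV[R]_md -> 'rV[R]_n)
    (l c : 'rV[R]_n -> R) (gamma : R)
    (hUc : compact U) (hUcv : convex_rV U)
    (hDc : compact D) (hDcv : convex_rV D)
    (hf_uc : forall e : R, 0 < e -> exists2 delta : R, 0 < delta &
       forall x x' u u' d d', U u -> U u' -> D d -> D d' ->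
         `|x - x'| < delta -> `|u - u'| < delta -> `|d - d'| < delta ->
         `|f x u d - f x' u' d'| < e)
    (hf_bd : exists M : R, forall x u d, U u -> D d -> `|f x u d| <= M)
    (hf_lip : exists L : R, forall x y u d, U u -> D d ->
       `|f x u d - f y u d| <= L * `|x - y|)
    (hl_bd : exists M : R, forall x, `|l x| <= M)
    (hl_lip : exists L : R, forall x y, `|l x - l y| <= L * `|x - y|)
    (hc_bd : exists M : R, forall x, `|c x| <= M)
    (hc_lip : exists L : R, forall x y, `|c x - c y| <= L * `|x - y|)
    (hgamma : 0 < gamma) :
  forall (x : 'rV[R]_n) (T : R), 0 < T ->
    V_gamma f U D l c gamma x =
    sup [set inf [set
           (let xi := traj f x u (lam u) in
            Num.min
              (inf [set ra_cost gamma l c xi t | t in `[0, T]])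
              (Num.max (expR (- (gamma * T)) * V_gamma f U D l c gamma (xi T))
                       (run_max gamma c xi T)))
         | u in admissible U]
    | lam in nonanticipative_strategy U D].
Proof.
move=> x T T0.
(* For empty [U] there are no admissible controls, and both sides take the infimum of the empty set
   for each strategy. *)
have [U0|/set0P[u0 Uu0]] := eqVneq U set0.
  have aU0 : admissible U = set0.
    by rewrite -subset0 => u [/(_ 0 (lexx _)) + _]; rewrite U0.
  congr sup; congr image; apply/funext => lam.
  by rewrite aU0 !image_set0.
(* For empty [D] no strategy can answer the constant control [u0], so both suprema are over the
   empty set. *)
have [D0|/set0P[d0 Dd0]] := eqVneq D set0.
  have sD0 : nonanticipative_strategy U D = set0.
    rewrite -subset0 => lam [/(_ _ (admissible_cst _ _ _ Uu0))[+ _] _].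
    by move=> /(_ 0 (lexx _)); rewrite D0.
  by rewrite /V_gamma sD0 !image_set0.
have [M hM] := hf_bd; have [L hL] := hf_lip.
have [Bl hBl] := hl_bd; have [Bc hBc] := hc_bd.
(* The given constants are enlarged to meet [0 <= M] and [1 <= L], and one bound serves both [l] and
   [c]. *)
apply: (@V_dpp R n mu md U D f (Num.max M 0) (Num.max L 1) hf_uc _ _ _ _ l c gamma
  (Num.max Bl Bc) _ _ _ u0 d0 Uu0 Dd0 T (ltW T0)).
- by rewrite le_max lexx orbT.
- by move=> y u d Uu Dd; rewrite le_max hM.
- by rewrite le_max lexx orbT.
- move=> y z u d Uu Dd; apply: le_trans (hL _ _ _ _ Uu Dd) _.
  by rewrite ler_wpM2r// le_max lexx.
- exact: ltW.
- by move=> y; rewrite le_max hBl.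
- by move=> y; rewrite le_max hBc orbT.
Qed.
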